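(* For all $v\in(0,1]$, $w\in(0,1]$ and $z\in(0,\varphi_v)$, $$\sum_{x=0}^\infty z^x Z_v(x,w)=\frac{1}{\tilde p(z)-\frac{z}{v}}\cdot\frac{z\,\tilde p(w)-w\,\tilde p(z)}{z-w},$$ where for $z=w$ the quotient $\frac{z\tilde p(w)-w\tilde p(z)}{z-w}$ is understood in the limiting sense.
   Context: Notation: $\mathbb{N}=\{1,2,\dots\}$, $\mathbb{N}_0=\{0,1,2,\dots\}$; $E[Y;A]:=E[Y\mathbf{1}_A]$; $\inf\emptyset=\infty$. Let $(p_k)_{k\in\mathbb{N}_0}$ be a probability mass function on $\mathbb{N}_0$ with $p_0>0$, and let $C_1,C_2,\dots$ be i.i.d. with $P(C_1=k)=p_k$. Put $\tilde p(z):=\sum_{k\ge 0}p_kz^k$, $z\in(0,1]$. Let $X_n=X_0+n-\sum_{i=1}^nC_i$, $n\in\mathbb{N}_0$; for $x\in\mathbb{Z}$, $P_x$ (expectation $E_x$) is the law under which $X_0=x$, and $P=P_0$, $E=E_0$. For $b\in\mathbb{Z}$ let $\tau_b^-=\inf\{n\in\mathbb{N}_0:X_n\le b\}$ and $\tau_b^+=\inf\{n\in\mathbb{N}_0:X_n\ge b\}$. For $v\in(0,1]$: $\varphi_v:=E[v^{\tau_1^+};\tau_1^+<\infty]$; $W_v(y):=\big(p_0E[v^{\tau_y^+};\tau_y^+<\tau_{-1}^-]\big)^{-1}$ for $y\in\mathbb{N}_0$, and $W_v(y):=0$ for integers $y<0$. For $v,w\in(0,1]$ and $x\in\mathbb{Z}$: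 $\Psi_v(x,w):=E_x[v^{\tau_{-1}^-}w^{-X(\tau_{-1}^-)};\tau_{-1}^-<\infty]$ and $Z_v(x,w):=\Psi_v(x,w)+\alpha_v(w)W_v(x)$, where the constant $\alpha_v(w)\in[0,\infty)$ is chosen so that $Z_v(0,w)=1$. *)

(* Defs.v *)
From mathcomp Require Export all_boot all_order all_algebra.
From mathcomp Require Export all_classical all_reals all_analysis.
Export Order.TTheory GRing.Theory Num.Theory.
Export numFieldNormedType.Exports.

Set Implicit Arguments.
Unset Strict Implicit.
Unset Printing Implicit Defensive.

Local Open Scope classical_set_scope.
Local Open Scope ring_scope.

(* Mutual independence.  Every subset of nat is measurable, so the events
   range over all sets of values. *)
Definition mutually_independent d (T : measurableType d) (R : realType)
    (P : probability T R) (C : nat -> {RV P >-> nat}) : Prop :=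
  forall (s : seq nat) (A : nat -> set nat), uniq s ->
    P (\bigcap_(i in [set` s]) (C i @^-1` A i)) =
    (\prod_(i <- s) P (C i @^-1` A i))%E.

(* Random times in nat \cup {oo}; None stands for oo. *)
Definition first_time (Q : pred nat) : option nat :=
  match pselect (exists n, Q n) with
  | left exQ => Some (ex_minn exQ)
  | right _ => None
  end.

Definition time_lt (s t : option nat) : bool :=
  match s, t with
  | Some m, Some n => (m < n)%N
  | Some _, None => true
  | None, _ => false
  end.

(* The default value 0 at oo is only ever used off the event of
   integration. *)
Definition time_val (t : option nat) : nat := odflt 0%N t.

(* E[Y; A] *)
Definition expect_on d (T : measurableType d) (R : realType)
    (P : probability T R) (Y : T -> R) (A : set T) : R :=
  fine ('E_P[Y \* (\1_A : T -> R)])%E.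

Definition pgf (R : realType) (p : nat -> R) (z : R) : R :=
  limn (pseries p z).

(* (z pgf(w) - w pgf(z)) / (z - w), extended to z = w by its limit. *)
Definition pgf_quotient (R : realType) (p : nat -> R) (z w : R) : R :=
  let q u := (u * pgf p w - w * pgf p u) / (u - w) in
  if z == w then lim (q u @[u --> w^']) else q z.

Section Walk.
Context d (T : measurableType d) (R : realType) (P : probability T R).
(* C i stands for the variable C_{i+1}, with law p. *)
Variables (p : nat -> R) (C : nat -> {RV P >-> nat}).

(* The walk with X_0 = x, all starting points being realised on the same
   space: its law under P is the law of X under P_x. *)
Definition walk (x : int) (n : nat) (omega : T) : int :=
  x + n%:Z - \sum_(i < n) (C i omega)%:Z.

Definition tau_down (x b : int) (omega : T) : option nat :=
  first_time (fun n => walk x n omega <= b).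

Definition tau_up (x b : int) (omega : T) : option nat :=
  first_time (fun n => b <= walk x n omega).

Definition phi (v : R) : R :=
  expect_on P (fun omega => v ^+ time_val (tau_up 0 1 omega))
    [set omega | tau_up 0 1 omega != None].

Definition W (v : R) (y : int) : R :=
  if 0 <= y then
    (p 0%N * expect_on P (fun omega => v ^+ time_val (tau_up 0 y omega))
       [set omega | time_lt (tau_up 0 y omega) (tau_down 0 (-1) omega)])^-1
  else 0.

Definition Psi (v : R) (x : int) (w : R) : R :=
  expect_on P
    (fun omega => let n := time_val (tau_down x (-1) omega) in
       v ^+ n * w ^ (- walk x n omega))
    [set omega | tau_down x (-1) omega != None].

(* The constant in [0, oo) for which Z v 0 w = 1; it is unique as W v 0 = 1 / p 0. *)
Definition alpha (v w : R) : R :=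
  get [set a : R | 0 <= a /\ Psi v 0 w + a * W v 0 = 1].

Definition Z (v : R) (x : int) (w : R) : R := Psi v x w + alpha v w * W v x.

End Walk.

(* Main.v *)
Require Import Defs.
From mathcomp Require Import all_boot all_order all_algebra.
From mathcomp Require Import all_classical all_reals all_analysis.
From mathcomp Require Import measurable_realfun.
From mathcomp Require Import ring lra zify.

(** Write G for the generating function of p. The functions W and Z(., w) both
    satisfy the one-step equation f(x) = v * sum_k p_k f(x + 1 - k) for x >= 0,
    with f = 0, respectively f(x) = w^(-x), at the negative integers. Multiply it
    by z^(x+1) / v and sum over x >= 0. The part of the inner sum with k <= x + 1
    is a Cauchy product; the part with k > x + 1 is a weighted tail of p that
    depends on w only, with t_m the sum of p_k w^(k-m) over k > m and tau the sum
    of t_m z^m. With F the generating function of f this gives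
      (G(z) - z / v) F = p_0 f(0) + t_0 - tau
    ([generating_function_equation]). For W, where p_0 W(0) = 1 and there is no
    tail, the right-hand side is 1, so G(z) - z / v is not zero. For Z, where
    Z(0) = 1 and p_0 + t_0 = G(w), it is G(w) - tau, which is the quotient of the
    theorem ([pgf_quotientE]); since tau is continuous in z this includes z = w.

    The one-step equations come from a first-step analysis of the walk stopped at
    its entrance into a set D ([stopped_value_first_step]). For Psi it applies
    directly. For W, which is the inverse of an expectation, the expectations
    from different starting points with the same target solve one linear
    recursion, which determines them up to a factor ([upward_exit_proportional]);
    thus W is the normalised solution of this recursion ([W_step]).

    It remains to see that the series of W converges for z < phi. The ratio
    W(x) / W(x+1) is the expectation of v^tau on the event that the walk from x
    reaches x + 1 before -1, where tau is the time to reach it. As x grows the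
    lower barrier recedes and the ratio tends to phi ([upward_exit_cvg_phi]), so
    the ratio test applies ([cvg_W_series]). *)

Local Open Scope classical_set_scope.
Local Open Scope ring_scope.

(** * Nonnegative series and power series *)

Section RealSeries.
Context {R : realType}.
Implicit Types a b f p t : nat -> R.

(** Nonnegative series are handled in the extended reals where sums may be freely
    interchanged; this transfers the results back to real convergence. *)
Lemma cvg_series_nneseries a (l : R) : (forall n, 0 <= a n) ->
  series a @ \oo --> l <-> (\sum_(n <oo) (a n)%:E = l%:E)%E.
Proof.
move=> a0.
have sE : (fun n => \sum_(0 <= i < n) (a i)%:E)%E = EFin \o series a.
  by apply/funext => n /=; rewrite sumEFin /series.
split=> [al|suml].
  by rewrite sE; apply/cvg_lim => //; apply: cvg_EFin => //; exact: nearW.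
have : (EFin \o series a) @ \oo --> l%:E.
  by rewrite -suml -sE; apply: is_cvg_nneseries => n _ _; rewrite lee_fin.
by move=> /fine_cvgP[].
Qed.

(** The double family equal to a_i b_(n-i) for i <= n and to 0 otherwise is
    nonnegative, so it may be summed over n first: the sum over n at fixed i is
    a_i B. *)
Lemma cauchy_product a b (A B : R) : (forall n, 0 <= a n) -> (forall n, 0 <= b n) ->
  series a @ \oo --> A -> series b @ \oo --> B ->
  series (fun n => \sum_(0 <= i < n.+1) a i * b (n - i)%N) @ \oo --> A * B.
Proof.
move=> a0 b0 /(cvg_series_nneseries _ _ a0) aA /(cvg_series_nneseries _ _ b0) bB.
pose F n i := if (i <= n)%N then a i * b (n - i)%N else 0.
have F0 n i : 0 <= F n i by rewrite /F; case: ifP => // _; exact: mulr_ge0.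
apply/cvg_series_nneseries => [n|].
  by apply: sumr_ge0 => i _; exact: mulr_ge0.
(* the terms of the inner sum with i > n vanish *)
transitivity (\sum_(n <oo) \sum_(i <oo) (F n i)%:E)%E.
  apply: eq_eseriesr => n _.
  rewrite (nneseries_split 0 n.+1); last by move=> k _; rewrite lee_fin.
  rewrite add0n [X in (_ + X)%E]eseries0 ?adde0; last first.
    by move=> k nk _; rewrite /F leqNgt nk.
  rewrite -sumEFin; apply: eq_big_nat => i /andP[_].
  by rewrite ltnS /F => ->.
rewrite nneseries_interchange; last by move=> n i; rewrite lee_fin.
transitivity (\sum_(i <oo) (B%:E * (a i)%:E))%E.
  apply: eq_eseriesr => i _.
  rewrite (nneseries_split 0 i); last by move=> k _; rewrite lee_fin.
  rewrite add0n big_nat_cond big1 ?add0e; last first.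
    by move=> n /andP[/andP[_ ni] _]; rewrite /F leqNgt ni.
  rewrite -nneseries_addn; last by move=> k; rewrite lee_fin.
  rewrite -bB muleC -nneseriesZl; last by move=> k _; rewrite lee_fin.
  apply: eq_eseriesr => k _.
  by rewrite /F leq_addl addnK EFinM.
rewrite nneseriesZl ?aA; last by move=> k _; rewrite lee_fin.
by rewrite -EFinM mulrC.
Qed.

Lemma ratio_test a (r : R) N : (forall n, 0 <= a n) ->
  0 <= r < 1 -> (forall n, (N <= n)%N -> a n.+1 <= r * a n) -> cvgn (series a).
Proof.
move=> a0 /andP[r0 r1] ratio.
have c : cvgn (series (fun n => a (N + n)%N)).
  apply: (@series_le_cvg _ _ (geometric (a N) r)) => // [n|n|].
  - by rewrite /= mulr_ge0 ?exprn_ge0.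
  - elim: n => [|n IH]; first by rewrite addn0 /= expr0 mulr1.
    rewrite addnS (le_trans (ratio _ (leq_addr _ _)))//.
    by rewrite /= exprS mulrCA ler_wpM2l.
  - by apply: is_cvg_geometric_series; rewrite ger0_norm.
have : series a N + series (fun n => a (N + n)%N) n @[n --> \oo] -->
    series a N + limn (series (fun n => a (N + n)%N)).
  by apply: cvgD; [exact: cvg_cst|exact: c].
rewrite (_ : (fun n => _) = (fun n => series a (n + N)%N)).
  by rewrite cvg_shiftn; exact: cvgP.
apply/funext => n; rewrite series_addn; congr (_ + _).
rewrite /series /= -{2}[N]add0n big_addn addnK.
by apply: eq_bigr => k _; rewrite addnC.
Qed.

Lemma cvg_pseries_bounded t (z : R) : (forall n, 0 <= t n <= 1) ->
  0 <= z < 1 -> cvgn (pseries t z).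
Proof.
move=> t01 /andP[z0 z1].
apply: (@series_le_cvg _ _ (geometric 1 z)) => [n|n|n|].
- by rewrite mulr_ge0 ?exprn_ge0//; case/andP: (t01 n).
- by rewrite /= mul1r exprn_ge0.
- by rewrite /= ler_wpM2r ?exprn_ge0//; case/andP: (t01 n).
- by apply: is_cvg_geometric_series; rewrite ger0_norm.
Qed.

(** For coefficients in [0, 1], each increment t_n (y^n - x^n) is nonnegative and
    at most y^n - x^n, so the geometric series controls the whole increment. *)
Lemma pseries_bounded_increment t (x y : R) : (forall n, 0 <= t n <= 1) ->
  0 <= x <= y -> y < 1 ->
  0 <= limn (pseries t y) - limn (pseries t x) <= (1 - y)^-1 - (1 - x)^-1.
Proof.
move=> t01 /andP[x0 xy] y1.
have y0 := le_trans x0 xy; have x1 := le_lt_trans xy y1.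
have cg (u : R) : 0 <= u -> u < 1 -> series (geometric 1 u) @ \oo --> (1 - u)^-1.
  move=> u0 u1; have := @cvg_geometric_series R 1 u.
  by rewrite mul1r ger0_norm//; exact.
have ct (u : R) : 0 <= u -> u < 1 -> cvgn (pseries t u).
  by move=> u0 u1; apply: cvg_pseries_bounded => //; rewrite u0.
have xyn n : x ^+ n <= y ^+ n by rewrite lerXn2r ?nnegrE.
rewrite -(cvg_lim (@Rhausdorff R) (cg _ y0 y1)) -(cvg_lim (@Rhausdorff R) (cg _ x0 x1)).
rewrite -lim_seriesB; [|exact: ct..].
rewrite -lim_seriesB; [|exact: cvgP (cg _ _ _)..].
apply/andP; split.
  apply: limr_ge; first by apply: is_cvg_seriesB; exact: ct.
  apply: nearW => n; apply: sumr_ge0 => k _.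
  rewrite /= -[_ - _]/(_ * _ - _ * _) -mulrBr mulr_ge0 ?subr_ge0//.
  by case/andP: (t01 k).
apply: lim_series_le.
- by apply: is_cvg_seriesB; exact: ct.
- by apply: is_cvg_seriesB; exact: cvgP (cg _ _ _).
move=> n; rewrite -[leLHS]/(_ * _ - _ * _) -[leRHS]/(_ * _ - _ * _) -!mulrBr.
by rewrite ler_wpM2r ?subr_ge0//; case/andP: (t01 n).
Qed.

Lemma pseries_bounded_continuous t (w : R) : (forall n, 0 <= t n <= 1) ->
  0 < w < 1 -> limn (pseries t u) @[u --> w] --> limn (pseries t w).
Proof.
move=> t01 /andP[w0 w1].
have inv_cvg : (1 - u)^-1 - (1 - w)^-1 @[u --> w] --> 0.
  rewrite -(subrr (1 - w)^-1); apply: cvgB; last exact: cvg_cst.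
  apply: cvgV; first by rewrite subr_eq0 gt_eqF.
  by apply: cvgB; [exact: cvg_cst|exact: cvg_id].
apply/cvgrPdist_le => e e0; near=> u.
have u0 : 0 < u by near: u; exact: lt_nbhsr.
have u1 : u < 1 by near: u; exact: lt_nbhsl.
apply: (@le_trans _ _ `|(1 - u)^-1 - (1 - w)^-1|); last first.
  by near: u; exact: cvgr0_norm_le.
have [wu|uw] := lerP w u.
  have wuI : 0 <= w <= u by rewrite ltW.
  have /andP[d0 d1] := pseries_bounded_increment t w u t01 wuI u1.
  by rewrite distrC ger0_norm// ger0_norm// (le_trans d0).
have uwI : 0 <= u <= w by rewrite !ltW.
have /andP[d0 d1] := pseries_bounded_increment t u w t01 uwI w1.
by rewrite ger0_norm// distrC ger0_norm// (le_trans d0).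
Unshelve. all: by end_near. Qed.

(** Multiplying the recursion by z^(n+1) and summing gives (z / v) F on the left
    and, on the right, the Cauchy product P F and the series of t, both without
    their terms of index 0. *)
Lemma generating_function_equation p f t (v z P F tau : R) :
  (forall n, 0 <= p n) -> (forall n, 0 <= f n) -> 0 <= z ->
  (forall n, f n / v = \sum_(0 <= k < n.+2) p k * f (n.+1 - k)%N + t n.+1) ->
  pseries p z @ \oo --> P -> pseries f z @ \oo --> F ->
  pseries t z @ \oo --> tau ->
  (P - z / v) * F = p 0%N * f 0%N + t 0%N - tau.
Proof.
move=> p0 f0 z0 frec pP fF ttau.
have /= pf := cauchy_product _ _ _ _
  (fun n => mulr_ge0 (p0 n) (exprn_ge0 n z0)) (fun n => mulr_ge0 (f0 n) (exprn_ge0 n z0)) pP fF.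
have PF : (series (fun n => \sum_(0 <= i < n.+1) p i * z ^+ i * (f (n - i)%N * z ^+ (n - i)))
    + pseries t z) @ \oo --> P * F + tau by exact: cvgD.
have : (fun n => p 0%N * f 0%N + t 0%N + z / v * pseries f z n) @ \oo
    --> p 0%N * f 0%N + t 0%N + z / v * F.
  by apply: cvgD; [exact: cvg_cst|apply: cvgM => //; exact: cvg_cst].
suff -> : (fun n => p 0%N * f 0%N + t 0%N + z / v * pseries f z n) =
    (fun n => (series (fun n => \sum_(0 <= i < n.+1) p i * z ^+ i * (f (n - i)%N * z ^+ (n - i)))
    + pseries t z) n.+1).
  have := PF; rewrite -cvg_shiftS => PF' /(cvg_unique (@Rhausdorff R) PF') E.
  lra.
apply/funext => n /=.
rewrite -[RHS]/(series _ n.+1 + series _ n.+1) /pseries !seriesEnat /=.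
rewrite -big_split big_nat_recl//= big_nat1 !expr0 subn0 !mulr1; congr (_ + _).
rewrite mulr_sumr; apply: eq_bigr => k _.
have -> : z / v * (f k * z ^+ k) = f k / v * z ^+ k.+1 by rewrite exprS; ring.
rewrite frec mulrDl mulr_suml; congr (_ + _).
rewrite [LHS]big_nat [RHS]big_nat; apply: eq_bigr => i /andP[_]; rewrite ltnS => ik.
by rewrite -[in z ^+ k.+1](subnKC ik) exprD; ring.
Qed.

Lemma cvg_pgf p (u : R) : (forall n, 0 <= p n) -> cvgn (series p) ->
  0 <= u <= 1 -> cvgn (pseries p u).
Proof.
move=> p0 cp /andP[u0 u1].
apply: (@series_le_cvg _ _ p) => // n /=; first by rewrite mulr_ge0 ?exprn_ge0.
by rewrite ler_piMr// exprn_ile1.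
Qed.

(** This is the sum of p_k w^(k-m) over k > m (see [weighted_tailE]): the expectation
    of w^(-X) on the event that one step from m - 1 leads to a negative point X.
    The closed form makes the recursion in m immediate. *)
Definition weighted_tail p (w : R) (m : nat) : R :=
  (limn (pseries p w) - \sum_(0 <= k < m.+1) p k * w ^+ k) / w ^+ m.

Section WeightedTail.
Variables (p : nat -> R) (w : R).
Hypotheses (p_ge0 : forall n, 0 <= p n) (p_sum1 : series p @ \oo --> (1 : R)).
Hypothesis hw : 0 < w <= 1.

Lemma weighted_tailE m : series (fun k => p (m.+1 + k)%N * w ^+ k.+1) @ \oo -->
  weighted_tail p w m.
Proof.
have /andP[w0 w1] := hw.
have w01 : 0 <= w <= 1 by rewrite ltW.
have wm0 : w ^+ m != 0 by rewrite expf_neq0 ?gt_eqF.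
have -> : series (fun k => p (m.+1 + k)%N * w ^+ k.+1) =
   (fun N => (pseries p w (N + m.+1)%N - \sum_(0 <= k < m.+1) p k * w ^+ k) / w ^+ m).
  apply/funext => N; rewrite /pseries series_addn /series /= addrAC subrr add0r.
  rewrite mulr_suml -{2}[m.+1]add0n big_addn addnK; apply: eq_bigr => k _.
  by rewrite addnC -addSnnS exprD; field.
apply: cvgM; last exact: cvg_cst.
by apply: cvgB; [rewrite (cvg_shiftn m.+1); exact: cvg_pgf p_ge0 (cvgP _ p_sum1) w01|exact: cvg_cst].
Qed.

Lemma weighted_tail_bounds m : 0 <= weighted_tail p w m <= 1.
Proof.
have /andP[w0 w1] := hw.
have c := weighted_tailE m; rewrite -(cvg_lim (@Rhausdorff R) c).
apply/andP; split.
  apply: limr_ge; first exact: cvgP c.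
  by apply: nearW => n; apply: sumr_ge0 => k _; rewrite mulr_ge0 ?exprn_ge0// ltW.
apply: limr_le; first exact: cvgP c.
apply: nearW => n; rewrite -(cvg_lim (@Rhausdorff R) p_sum1).
apply: le_trans (nondecreasing_cvgn_le _ (cvgP _ p_sum1) (n + m.+1)%N); last first.
  by apply/nondecreasing_series => k _ _.
rewrite series_addn ler_wpDl ?sumr_ge0//.
have -> : \sum_(m.+1 <= k < n + m.+1) p k = \sum_(0 <= k < n) p (k + m.+1)%N.
  by rewrite -{1}[m.+1]add0n big_addn addnK.
apply: ler_sum => k _.
by rewrite addnC ler_piMr// exprn_ile1// ltW.
Qed.

(** Sum the recursion w t_(m+1) = t_m - w p_(m+1) against z^(m+1). *)
Lemma weighted_tail_gf (z tau : R) : cvgn (pseries p z) ->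
  pseries (weighted_tail p w) z @ \oo --> tau ->
  (z - w) * tau = w * (limn (pseries p z) - limn (pseries p w)).
Proof.
have /andP[w0 w1] := hw; move=> pz tz.
have step m : w * weighted_tail p w m.+1 = weighted_tail p w m - w * p m.+1.
  have wm0 : w ^+ m != 0 by rewrite expf_neq0 ?gt_eqF.
  rewrite /weighted_tail [in LHS]big_nat_recr//= exprS.
  by set S := \sum_(0 <= k < m.+1) _; field; rewrite wm0 gt_eqF.
have sumE n : w * (pseries (weighted_tail p w) z n.+1 - weighted_tail p w 0) =
    z * pseries (weighted_tail p w) z n - w * (pseries p z n.+1 - p 0%N).
  rewrite /pseries /series /= !big_nat_recl// !expr0 !mulr1 ![_ + \sum_(_ <= _ < _) _]addrC !addrK.
  rewrite !mulr_sumr -sumrB; apply: eq_bigr => k _.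
  by rewrite mulrA step exprS; ring.
have lhs : w * (pseries (weighted_tail p w) z n.+1 - weighted_tail p w 0) @[n --> \oo]
    --> w * (tau - weighted_tail p w 0).
  apply: cvgM; first exact: cvg_cst.
  by apply: cvgB; [rewrite (cvg_shiftS (pseries _ z))|exact: cvg_cst].
have rhs : w * (pseries (weighted_tail p w) z n.+1 - weighted_tail p w 0) @[n --> \oo]
    --> z * tau - w * (limn (pseries p z) - p 0%N).
  under eq_fun do rewrite sumE.
  apply: cvgB; first by apply: cvgM => //; exact: cvg_cst.
  apply: cvgM; first exact: cvg_cst.
  by apply: cvgB; [rewrite (cvg_shiftS (pseries _ z))|exact: cvg_cst].
have := cvg_unique (@Rhausdorff R) lhs rhs.
rewrite /weighted_tail big_nat1 !expr0 mulr1 divr1 => E.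
transitivity (z * tau - w * (limn (pseries p z) - p 0%N)
  - w * tau + w * (limn (pseries p z) - p 0%N)); first by ring.
by rewrite -E; ring.
Qed.

(** For z != w this is [weighted_tail_gf] divided by z - w. The right-hand side is
    continuous in z, hence it is also the limit that defines the quotient at
    z = w. *)
Lemma pgf_quotientE (z : R) : 0 < z < 1 ->
  pgf_quotient p z w = pgf p w - limn (pseries (weighted_tail p w) z).
Proof.
have /andP[w0 w1] := hw; move=> z01.
set q := fun u => (u * pgf p w - w * pgf p u) / (u - w).
have qE u : 0 < u < 1 -> u != w ->
    q u = pgf p w - limn (pseries (weighted_tail p w) u).
  move=> /andP[u0 u1] uw.
  have ct : cvgn (pseries (weighted_tail p w) u).
    apply: cvg_pseries_bounded; first exact: weighted_tail_bounds.
    by rewrite ltW.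
  have cp : cvgn (pseries p u).
    by apply: cvg_pgf (cvgP _ p_sum1) _ => //; rewrite !ltW.
  have := weighted_tail_gf u _ cp ct.
  rewrite /q -!/(pgf p _) => E; have uw0 : u - w != 0 by rewrite subr_eq0.
  apply: (mulIf uw0); rewrite divfK// mulrBl [limn (pseries _ u) * _]mulrC E; ring.
rewrite /pgf_quotient -/q; case: eqP => [zw|/eqP]; last exact: qE.
apply/cvg_lim => //.
have lim_tail : pgf p w - limn (pseries (weighted_tail p w) u) @[u --> z^'] -->
    pgf p w - limn (pseries (weighted_tail p w) z).
  apply: cvgB; first exact: cvg_cst.
  apply: cvg_within_filter; apply: pseries_bounded_continuous => //.
  exact: weighted_tail_bounds.
rewrite -[in w^']zw; apply: cvg_trans lim_tail; apply: near_eq_cvg.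
have /andP[z0 z1] := z01; near=> u.
rewrite qE//; last by rewrite -zw; near: u; exact: nbhs_dnbhs_neq.
by apply/andP; split; near: u; apply: nbhs_dnbhs; [exact: lt_nbhsr|exact: lt_nbhsl].
Unshelve. all: by end_near. Qed.
End WeightedTail.

End RealSeries.

(** * First times *)

Lemma first_timeP (Q : pred nat) n :
  reflect (Q n /\ forall m, (m < n)%N -> ~~ Q m) (first_time Q == Some n).
Proof.
rewrite /first_time; case: pselect => [exQ|nexQ]; last first.
  by constructor => -[Qn _]; apply: nexQ; exists n.
case: ex_minnP => k Qk kmin; apply: (iffP eqP) => [[<-]|[Qn nmin]].
  by split=> // m mk; apply/negP => /kmin; rewrite leqNgt mk.
by congr Some; apply/eqP; rewrite eqn_leq kmin//= leqNgt; apply/negP => /nmin /negP.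
Qed.

Lemma first_time_NoneP (Q : pred nat) :
  reflect (forall n, ~~ Q n) (first_time Q == None).
Proof.
rewrite /first_time; case: pselect => [exQ|nexQ]; constructor.
  by case: exQ => n Qn /(_ n); rewrite Qn.
by move=> n; apply/negP => Qn; apply: nexQ; exists n.
Qed.

Lemma eq_first_time (Q Q' : pred nat) : Q =1 Q' -> first_time Q = first_time Q'.
Proof. by move=> /funext ->. Qed.

Lemma first_time0 (Q : pred nat) : (first_time Q == Some 0%N) = Q 0%N.
Proof. by apply/first_timeP/idP => [[]|]. Qed.

Lemma first_timeS (Q : pred nat) n : (first_time Q == Some n.+1) =
  ~~ Q 0%N && (first_time (fun m => Q m.+1) == Some n).
Proof.
apply/first_timeP/andP => [[Qn before]|[Q0 /first_timeP[Qn before]]].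
  by split; [exact: before|apply/first_timeP; split => // m mn; exact: before].
by split => // -[|m]//; exact: before.
Qed.

(** * The walk stopped at its entrance into a set *)

Section StoppedWalk.
Context {d : measure_display} {T : measurableType d} {R : realType} {P : probability T R}.
Implicit Types (C : nat -> {RV P >-> nat}) (omega : T).

Definition shift_steps C m : nat -> {RV P >-> nat} := fun i => C (m + i)%N.

Lemma walk0 C (x : int) omega : walk C x 0 omega = x.
Proof. by rewrite /walk big_ord0 addr0 subr0. Qed.

Lemma walkS C (x : int) n omega : walk C x n.+1 omega =
  walk (shift_steps C 1) (x + 1 - (C 0%N omega)%:Z) n omega.
Proof.
rewrite /walk big_ord_recl /= /shift_steps.
by rewrite -addn1 PoszD; ring.
Qed.

Lemma walk_translate C (x y : int) n omega :
  walk C (x + y) n omega = x + walk C y n omega.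
Proof. by rewrite /walk !addrA. Qed.

Variables (v : R) (D : pred int) (g : int -> R).

(** The first hitting time of D. All the expectations of the theorem are of the
    form E_x[v^tau g(X_tau); tau < oo] for such a time tau and a payoff g on D. *)
Definition exit_time C (x : int) omega : option nat :=
  first_time (fun n => D (walk C x n omega)).

Definition payoff C (x : int) omega : R :=
  if exit_time C x omega is Some n then v ^+ n * g (walk C x n omega) else 0.

(** The contribution of the event that the exit time is n, written as a recursion
    along the path so that the first step can be split off (see [payoff_atE]). *)
Fixpoint payoff_at n C (x : int) omega : R :=
  match n with
  | 0 => if D x then g x else 0
  | n'.+1 => if D x then 0 else v * payoff_at n' (shift_steps C 1) (x + 1 - (C 0%N omega)%:Z) omega
  end.

Lemma payoff_atE n C x omega : payoff_at n C x omega =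
  if exit_time C x omega == Some n then v ^+ n * g (walk C x n omega) else 0.
Proof.
rewrite /exit_time; elim: n C x => [|n IH] C x /=.
  by rewrite first_time0 walk0 expr0 mul1r.
rewrite first_timeS walk0 IH walkS.
under [in RHS]eq_first_time do rewrite walkS.
by case: (D x) => //=; case: ifP => _; rewrite ?mulr0// exprS mulrA.
Qed.

Hypotheses (hv : 0 <= v <= 1) (hg : forall y, D y -> 0 <= g y <= 1).

Lemma payoff_bounds C x omega : 0 <= payoff C x omega <= 1.
Proof.
have /andP[v0 v1] := hv.
rewrite /payoff; case E : (exit_time C x omega) => [n|]; last by rewrite lexx ler01.
move/eqP/first_timeP : E => [/hg/andP[g0 g1] _].
rewrite mulr_ge0 ?exprn_ge0//= mulr_ile1 ?exprn_ge0 ?exprn_ile1//.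
Qed.

Lemma payoff_at_ge0 n C x omega : 0 <= payoff_at n C x omega.
Proof.
have /andP[v0 v1] := hv.
elim: n C x => [|n IH] C x /=; case: ifP => // Dx; last by rewrite mulr_ge0.
by case/andP: (hg _ Dx).
Qed.

Lemma payoff_sum C x omega :
  ((payoff C x omega)%:E = \sum_(n <oo) (payoff_at n C x omega)%:E)%E.
Proof.
rewrite /payoff; case E : (exit_time C x omega) => [n|]; last first.
  by rewrite eseries0// => k _ _; rewrite payoff_atE E.
rewrite (@nneseriesD1 _ _ n)//; last by move=> k _; rewrite lee_fin payoff_at_ge0.
rewrite eseries0 ?adde0; first by rewrite payoff_atE E eqxx.
move=> k _ /= kn; rewrite payoff_atE E; case: eqP => // -[nk].
by rewrite nk eqxx in kn.
Qed.

Lemma measurable_fun_of_nat (X : {RV P >-> nat}) (f : nat -> T -> R) :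
  (forall k, measurable_fun setT (f k)) -> measurable_fun setT (fun omega => f (X omega) omega).
Proof.
move=> mf _ Y mY; rewrite setTI.
have -> : (fun omega => f (X omega) omega) @^-1` Y =
    \bigcup_k (X @^-1` [set k] `&` f k @^-1` Y).
  apply/seteqP; split=> [omega Yf|omega [k _ [/= <-]]//].
  by exists (X omega).
apply: bigcup_measurable => k _; apply: measurableI.
  by rewrite -[_ @^-1` _]setTI; exact: measurable_funPT.
by rewrite -[_ @^-1` _]setTI; exact: mf.
Qed.

Lemma measurable_payoff_at n C x : measurable_fun setT (payoff_at n C x).
Proof.
elim: n C x => [|n IH] C x; first exact: measurable_cst.
have [Dx|Dx] := boolP (D x).
  by rewrite [payoff_at _ _ _](_ : _ = cst 0)//; apply/funext => omega /=; rewrite Dx.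
rewrite [payoff_at _ _ _](_ : _ = fun omega =>
    v * payoff_at n (shift_steps C 1) (x + 1 - (C 0%N omega)%:Z) omega); last first.
  by apply/funext => omega /=; rewrite (negbTE Dx).
apply: measurable_funM; first exact: measurable_cst.
exact: (measurable_fun_of_nat (C 0%N) (fun k => payoff_at n (shift_steps C 1) (x + 1 - k%:Z))).
Qed.

Lemma measurable_payoff C x : measurable_fun setT (EFin \o payoff C x).
Proof.
rewrite (_ : EFin \o _ = fun omega => (\sum_(n <oo) (payoff_at n C x omega)%:E)%E).
  apply: ge0_emeasurable_sum => [k omega _ _|k _].
    by rewrite lee_fin payoff_at_ge0.
  by apply/measurable_EFinP; exact: measurable_payoff_at.
by apply/funext => omega; rewrite -payoff_sum.
Qed.

Variables (p : nat -> R) (C : nat -> {RV P >-> nat}).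
Hypotheses (p_ge0 : forall k, 0 <= p k).
Hypotheses (C_indep : mutually_independent C)
  (C_law : forall i k, P (C i @^-1` [set k]) = (p k)%:E).

(** The recursion of [payoff_at] averaged over the law p of each step. *)
Fixpoint expected_payoff_at n (x : int) : \bar R :=
  match n with
  | 0 => if D x then (g x)%:E else 0
  | n'.+1 => if D x then 0 else v%:E * \sum_(k <oo) (p k)%:E * expected_payoff_at n' (x + 1 - k%:Z)
  end%E.

Lemma expected_payoff_at_ge0 n x : (0 <= expected_payoff_at n x)%E.
Proof.
have /andP[v0 v1] := hv.
elim: n x => [|n IH] x /=; case: ifP => // Dx.
  by rewrite lee_fin; case/andP: (hg _ Dx).
apply: mule_ge0; first by rewrite lee_fin.
by apply: nneseries_ge0 => k _ _; rewrite mule_ge0 ?lee_fin.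
Qed.

Definition cylinder m (ks : nat -> nat) : set T :=
  \bigcap_(i in [set` iota 0 m]) C i @^-1` [set ks i].

Lemma measurable_cylinder m ks : measurable (cylinder m ks).
Proof.
rewrite /cylinder bigcap_seq; apply: bigsetI_measurable => i _.
by rewrite -[_ @^-1` _]setTI; exact: measurable_funPT.
Qed.

Lemma in_cylinder m ks omega : cylinder m ks omega <-> (forall i, (i < m)%N -> C i omega = ks i).
Proof.
split=> h i; first by move=> im; apply: h; rewrite /= mem_iota.
by rewrite /= mem_iota => /h.
Qed.

(** The first m steps are prescribed in order to make an induction on n possible:
    the cylinder is cut according to the value k of the next step, and
    independence multiplies its probability by p_k. *)
Lemma integral_payoff_at n m ks x :
  (\int[P]_(omega in cylinder m ks) (payoff_at n (shift_steps C m) x omega)%:E =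
   (\prod_(i < m) p (ks i))%:E * expected_payoff_at n x)%E.
Proof.
have /andP[v0 v1] := hv.
have Pcyl m' ks' : P (cylinder m' ks') = (\prod_(i < m') p (ks' i))%:E.
  rewrite /cylinder C_indep ?iota_uniq//.
  have -> : iota 0 m' = index_iota 0 m' by rewrite /index_iota subn0.
  by rewrite big_mkord -prodEFin; apply: eq_bigr => i _; rewrite C_law.
elim: n m ks x => [|n IH] m ks x /=.
  rewrite integral_cst; last exact: measurable_cylinder.
  rewrite muleC; have -> : (if D x then g x else 0)%:E = (if D x then (g x)%:E else 0)%E.
    by case: (D x).
  by congr (_ * _)%E; exact: Pcyl.
have [Dx|Dx] := boolP (D x); first by rewrite integral0 mule0.
(* upd k prescribes the value k for the step of index m *)
pose upd k i := if (i < m)%N then ks i else k.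
have cylS : cylinder m ks = \bigcup_k cylinder m.+1 (upd k).
  apply/seteqP; split=> omega.
    move=> /in_cylinder h; exists (C m omega) => //; apply/in_cylinder => i.
    by rewrite /upd ltnS leq_eqVlt; case: (ltnP i m) => [/h//|_]; rewrite orbF => /eqP ->.
  move=> [k _ /in_cylinder h]; apply/in_cylinder => i im.
  by have := h i (ltnW im); rewrite /upd im.
have cylC k omega : cylinder m.+1 (upd k) omega -> C m omega = k.
  by move=> /in_cylinder/(_ m (ltnSn m)); rewrite /upd ltnn.
have mpay k : measurable_fun setT (fun omega => (payoff_at n (shift_steps C m.+1) (x + 1 - k%:Z) omega)%:E).
  by apply/measurable_EFinP; exact: measurable_payoff_at.
have shiftS : shift_steps (shift_steps C m) 1 = shift_steps C m.+1.
  by apply/funext => i; rewrite /shift_steps add1n addnS addSn.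
rewrite cylS ge0_integral_bigcup; first last.
- apply/trivIsetP => i j _ _ ij; apply/seteqP; split=> // omega [/cylC Ci /cylC Cj].
  by move: ij; rewrite -Ci -Cj eqxx.
- by move=> omega _; rewrite lee_fin mulr_ge0// payoff_at_ge0.
- apply: (measurable_funS measurableT) => //; apply/measurable_EFinP.
  by have := measurable_payoff_at n.+1 (shift_steps C m) x; rewrite /= (negbTE Dx).
- by move=> k; exact: measurable_cylinder.
transitivity (\sum_(k <oo) (((\prod_(i < m) p (ks i)) * v)%:E * ((p k)%:E * expected_payoff_at n (x + 1 - k%:Z))))%E.
  apply: eq_eseriesr => k _.
  transitivity (\int[P]_(omega in cylinder m.+1 (upd k))
      (v%:E * (payoff_at n (shift_steps C m.+1) (x + 1 - k%:Z) omega)%:E))%E.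
    apply: eq_integral => omega /set_mem /cylC Cm.
    by rewrite /shift_steps addn0 Cm -EFinM -/(shift_steps _ _) -shiftS.
  rewrite ge0_integralZl//; first last.
  - by move=> omega _; rewrite lee_fin payoff_at_ge0.
  - exact: (measurable_funS measurableT).
  - exact: measurable_cylinder.
  rewrite IH big_ord_recr/= {2}/upd ltnn.
  under eq_bigr do rewrite /upd ltn_ord.
  by rewrite !EFinM -!muleA [LHS]muleCA.
rewrite nneseriesZl ?EFinM ?muleA// => k _.
by rewrite mule_ge0 ?lee_fin// expected_payoff_at_ge0.
Qed.

Definition expected_payoff (x : int) : \bar R := (\int[P]_omega (payoff C x omega)%:E)%E.

Lemma expected_payoff_sum x : (expected_payoff x = \sum_(n <oo) expected_payoff_at n x)%E.
Proof.
rewrite /expected_payoff; under eq_integral do rewrite payoff_sum.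
rewrite integral_nneseries//; last first.
- by move=> n omega _; rewrite lee_fin payoff_at_ge0.
- by move=> n; apply/measurable_EFinP; exact: measurable_payoff_at.
apply: eq_eseriesr => n _.
have := integral_payoff_at n 0 id x; rewrite big_ord0 mul1e => <-.
congr (integral _ _ _); last by apply/seteqP; split=> // omega _; apply/in_cylinder.
Qed.

Lemma expected_payoff_bounds x : (0 <= expected_payoff x <= 1)%E.
Proof.
apply/andP; split.
  by apply: integral_ge0 => omega _; rewrite lee_fin; case/andP: (payoff_bounds C x omega).
rewrite -(probability_setT P) -[P setT]mul1e -integral_cst//.
apply: ge0_le_integral => //.
- by move=> omega _; rewrite lee_fin; case/andP: (payoff_bounds C x omega).
- exact: measurable_payoff.
- by move=> omega _; rewrite lee_fin; case/andP: (payoff_bounds C x omega).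
Qed.

Definition stopped_value x : R := fine (expected_payoff x).

Lemma stopped_valueE x : (stopped_value x)%:E = expected_payoff x.
Proof.
have /andP[h0 h1] := expected_payoff_bounds x; rewrite fineK// ge0_fin_numE//.
by rewrite (le_lt_trans h1)// ltry.
Qed.

Lemma stopped_value_bounds x : 0 <= stopped_value x <= 1.
Proof. by rewrite -!lee_fin stopped_valueE expected_payoff_bounds. Qed.

Lemma stopped_value_in x : D x -> stopped_value x = g x.
Proof.
move=> Dx; apply: EFin_inj; rewrite stopped_valueE expected_payoff_sum.
rewrite nneseries_recl//; last by move=> n _; exact: expected_payoff_at_ge0.
by rewrite /= Dx eseries0 ?adde0// => -[|k] //= _ _; rewrite Dx.
Qed.

(** Off D the walk makes one step, which costs a factor v, and then starts afresh.
    The sums over the exit time and over the first step are nonnegative, so they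
    commute. *)
Lemma stopped_value_first_step x : ~~ D x ->
  series (fun k => v * (p k * stopped_value (x + 1 - k%:Z))) @ \oo --> stopped_value x.
Proof.
move=> /negbTE Dx; have /andP[v0 v1] := hv.
apply/cvg_series_nneseries => [k|].
  by rewrite !mulr_ge0//; case/andP: (stopped_value_bounds (x + 1 - k%:Z)).
rewrite stopped_valueE expected_payoff_sum [RHS]nneseries_recl//; last by move=> n _; exact: expected_payoff_at_ge0.
rewrite /= Dx add0e -(nneseries_addn 1); last by move=> n; exact: expected_payoff_at_ge0.
transitivity (\sum_(n <oo) \sum_(k <oo) v%:E * ((p k)%:E * expected_payoff_at n (x + 1 - k%:Z)))%E.
  rewrite nneseries_interchange => [|n k]; last first.
    by rewrite !mule_ge0 ?lee_fin ?expected_payoff_at_ge0.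
  apply: eq_eseriesr => k _.
  rewrite !EFinM stopped_valueE expected_payoff_sum -!nneseriesZl// => n _;
    by rewrite ?mule_ge0 ?lee_fin ?expected_payoff_at_ge0.
apply: eq_eseriesr => n _; rewrite addn1 /= Dx nneseriesZl// => k _.
by rewrite mule_ge0 ?lee_fin ?expected_payoff_at_ge0.
Qed.
End StoppedWalk.

(** * The scale function W *)

Section Scale.
Context {d : measure_display} {T : measurableType d} {R : realType} {P : probability T R}.
Variables (p : nat -> R) (C : nat -> {RV P >-> nat}) (v : R).
Hypotheses (p_ge0 : forall k, 0 <= p k) (p_sum1 : series p @ \oo --> (1 : R))
  (p0_gt0 : 0 < p 0%N) (C_indep : mutually_independent C)
  (C_law : forall i k, P (C i @^-1` [set k]) = (p k)%:E)
  (hv : 0 < v <= 1).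

Lemma expect_on_stopped (D : pred int) (g : int -> R) x (Y : T -> R) (A : set T) :
  (forall omega, A omega -> Y omega = payoff v D g C x omega) ->
  (forall omega, ~ A omega -> payoff v D g C x omega = 0) ->
  expect_on P Y A = stopped_value v D g C x.
Proof.
move=> YA nA; rewrite /expect_on unlock /stopped_value /expected_payoff; congr fine.
apply: eq_integral => omega _ /=; rewrite indicE.
have [/set_mem/YA ->|] := boolP (omega \in A); first by rewrite mulr1.
by move=> /negP oA; rewrite mulr0 nA// => /mem_set.
Qed.

Definition outside (y x : int) : bool := (y <= x) || (x <= -1).
Definition above (y x : int) : R := (y <= x)%R%:R.

(** The expectation of v^tau_y on tau_y < tau_-1 for the walk from x: it
    is stopped when it leaves the interval from 0 to y - 1 and paid 1 if it leaves
    it upwards. *)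
Definition upward_exit (y : int) := stopped_value v (outside y) (above y) C.

Let v01 : 0 <= v <= 1.
Proof. by case/andP: hv => v0 ->; rewrite ltW. Qed.

Let above01 y x : outside y x -> 0 <= above y x <= 1.
Proof. by rewrite /above; case: (y <= x) => _; rewrite ?ler01 ?lexx. Qed.

(** For y >= 0 the barriers y and -1 are never crossed at the same time, so
    reaching y first means that the walk is at or above y when it is stopped. *)
Lemma upward_exit_expectation (y : nat) :
  expect_on P (fun omega => v ^+ time_val (tau_up C 0 y%:Z omega))
    [set omega | time_lt (tau_up C 0 y%:Z omega) (tau_down C 0 (-1) omega)] = upward_exit y%:Z 0.
Proof.
apply: expect_on_stopped => omega; rewrite /= /payoff /tau_up /tau_down /exit_time.
  case U : (first_time (fun n => y%:Z <= _)) => [m|]//= tlt.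
  move/eqP/first_timeP : U => [Um Ub].
  have /eqP -> : first_time (fun n => outside y%:Z (walk C 0 n omega)) == Some m.
    apply/first_timeP; split=> [|k km]; first by rewrite /outside Um.
    rewrite /outside negb_or Ub//=; apply/negP => Lk; move: tlt.
    case L : (first_time _) => [l|].
      move/eqP/first_timeP : L => [_ /(_ k)] Lb ml.
      by have := Lb (ltn_trans km ml); rewrite Lk.
    by move/eqP/first_time_NoneP : L => /(_ k); rewrite Lk.
  by rewrite /above Um mulr1.
move=> tlt; case E : (first_time _) => [m|]//.
move/eqP/first_timeP : E => [Em Eb].
rewrite /above; case Um : (y%:Z <= _); last by rewrite mulr0.
exfalso; apply: tlt.
have /eqP -> : first_time (fun n => y%:Z <= walk C 0 n omega) == Some m.
  by apply/first_timeP; split=> // k /Eb; rewrite negb_or => /andP[].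
case L : (first_time _) => [l|]//=.
move/eqP/first_timeP : L => [Ll _]; rewrite ltnNge leq_eqVlt; apply/negP => /orP[/eqP lm|lm].
  move: Ll Um; rewrite lm; lia.
by have := Eb _ lm; rewrite /outside Ll orbT.
Qed.

Lemma upward_exit_target (y : int) : upward_exit y y = 1.
Proof.
rewrite /upward_exit (stopped_value_in _ _ _ v01 (@above01 y) p C p_ge0 C_indep C_law) ?/above ?lexx//.
by rewrite /outside lexx.
Qed.

Lemma upward_exit_neg (y x : int) : 0 <= y -> x < 0 -> upward_exit y x = 0.
Proof.
move=> y0 x0; rewrite /upward_exit (stopped_value_in _ _ _ v01 (@above01 y) p C p_ge0 C_indep C_law).
  by rewrite /above (_ : (y <= x) = false) //; lia.
by rewrite /outside; apply/orP; right; lia.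
Qed.

(** No term with k > x + 1 survives since the value vanishes at negative points.
    The recursion therefore determines the value at x + 1 from those at 0, ..., x. *)
Lemma upward_exit_step (y x : nat) : (x < y)%N ->
  upward_exit y%:Z x%:Z / v = \sum_(0 <= k < x.+2) p k * upward_exit y%:Z (x.+1 - k)%N%:Z.
Proof.
move=> xy; have /andP[v0 _] := hv.
have : ~~ outside y%:Z x%:Z by rewrite /outside; lia.
move/(stopped_value_first_step _ _ _ v01 (@above01 y%:Z) p C p_ge0 C_indep C_law) => H.
apply: (mulIf (lt0r_neq0 v0)); rewrite divfK ?lt0r_neq0//.
(* the partial sums are constant from index x + 2 on *)
suff: series (fun k => v * (p k * upward_exit y%:Z (x%:Z + 1 - k%:Z))) @ \oo -->
    (\sum_(0 <= k < x.+2) p k * upward_exit y%:Z (x.+1 - k)%N%:Z) * v.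
  exact: cvg_unique.
rewrite -(cvg_shiftn x.+2); apply: cvg_near_cst; apply: nearW => n /=.
rewrite series_addn [X in _ + X]big_nat_cond big1 ?addr0; last first.
  move=> k /andP[/andP[xk _] _]; rewrite upward_exit_neg ?mulr0//; lia.
rewrite /series /= mulr_suml [LHS]big_nat [RHS]big_nat; apply: eq_bigr => k /andP[_ kx].
rewrite mulrC; congr (_ * upward_exit _ _ * _); lia.
Qed.

Lemma upward_exit_gt0 (y x : nat) : (x <= y)%N -> 0 < upward_exit y%:Z x%:Z.
Proof.
have /andP[v0 _] := hv.
move=> xy; rewrite -(subKn xy); elim: (y - x)%N (leq_subr x y) => [|j IH] jy.
  by rewrite subn0 upward_exit_target.
have yj : (y - j.+1 < y)%N by lia.
have := upward_exit_step y (y - j.+1) yj.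
rewrite big_nat_recl// subn0 (_ : (y - j.+1).+1 = y - j)%N; last by lia.
move=> E; rewrite -(pmulr_lgt0 _ (_ : 0 < v^-1)) ?invr_gt0// E.
rewrite ltr_pwDl ?mulr_gt0 ?IH//; first by lia.
apply: sumr_ge0 => k _; rewrite mulr_ge0//.
by have /andP[] := stopped_value_bounds _ _ _ v01 (@above01 y%:Z) C ((y - j - k.+1)%N%:Z).
Qed.

(** Both functions solve the same linear recursion below min(y, y'), whose solutions
    are determined by the value at 0. This replaces the strong Markov property at
    the passage through x. *)
Lemma upward_exit_proportional (y y' x : nat) : (x <= y)%N -> (x <= y')%N ->
  upward_exit y%:Z x%:Z * upward_exit y'%:Z 0 = upward_exit y'%:Z x%:Z * upward_exit y%:Z 0.
Proof.
elim/ltn_ind: x => -[|x] IH xy xy'; first by rewrite mulrC.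
pose S z := \sum_(0 <= k < x.+1) p k.+1 * upward_exit z%:Z (x - k)%N%:Z.
have step (z : nat) : (x < z)%N -> p 0%N * upward_exit z%:Z x.+1%:Z = upward_exit z%:Z x%:Z / v - S z.
  by move=> xz; rewrite upward_exit_step// big_nat_recl// subn0 addrK.
have SE : S y * upward_exit y'%:Z 0 = S y' * upward_exit y%:Z 0.
  by rewrite !mulr_suml; apply: eq_bigr => k _; rewrite -!mulrA IH//; lia.
apply: (mulfI (lt0r_neq0 p0_gt0)); rewrite !mulrA !step// !mulrBl SE.
by rewrite mulrAC IH ?(ltnW xy) ?(ltnW xy')// mulrAC.
Qed.

Lemma W_nat (x : nat) : W p C v x%:Z = (p 0%N * upward_exit x%:Z 0)^-1.
Proof. by rewrite /W le0z_nat upward_exit_expectation. Qed.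

Lemma W_gt0 (x : nat) : 0 < W p C v x%:Z.
Proof. by rewrite W_nat invr_gt0 mulr_gt0// (upward_exit_gt0 x 0). Qed.

Lemma upward_exitE (x y : nat) : (x <= y)%N -> upward_exit y%:Z x%:Z = p 0%N * upward_exit y%:Z 0 * W p C v x%:Z.
Proof.
move=> xy; have := upward_exit_proportional y x x xy (leqnn _); rewrite upward_exit_target mul1r => E.
have hx : upward_exit x%:Z 0 != 0 by rewrite lt0r_neq0// (upward_exit_gt0 x 0).
rewrite W_nat invfM -E; field.
by rewrite hx lt0r_neq0.
Qed.

(** By [upward_exitE], W is a multiple of upward_exit (x + 1) on 0, ..., x + 1. *)
Lemma W_step (x : nat) : W p C v x%:Z / v =
  \sum_(0 <= k < x.+2) p k * W p C v (x.+1 - k)%N%:Z.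
Proof.
have := upward_exit_step x.+1 x (ltnSn x).
have c0 : p 0%N * upward_exit x.+1%:Z 0 != 0 by rewrite lt0r_neq0// mulr_gt0// (upward_exit_gt0 x.+1 0).
rewrite upward_exitE// => E; apply: (mulfI c0); rewrite mulrA E mulr_sumr.
apply: eq_bigr => k _; rewrite upward_exitE ?leq_subr//; ring.
Qed.

Lemma W0 : W p C v 0 = (p 0%N)^-1.
Proof. by rewrite (W_nat 0) upward_exit_target mulr1. Qed.

Lemma W_ratio (x : nat) : W p C v x.+1%:Z * upward_exit x.+1%:Z x%:Z = W p C v x%:Z.
Proof.
have hx : upward_exit x.+1%:Z 0 != 0 by rewrite lt0r_neq0// (upward_exit_gt0 x.+1 0).
rewrite upward_exitE// [in LHS]W_nat; field.
by rewrite hx lt0r_neq0.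
Qed.

Lemma phiE : phi C v = stopped_value v (fun x => 1 <= x) (fun=> 1) C 0.
Proof.
apply: expect_on_stopped => omega; rewrite /= /payoff /exit_time -/(tau_up C 0 1 omega).
  by case: (tau_up _ _ _ _) => [m|]//= _; rewrite mulr1.
by case: (tau_up _ _ _ _) => [m|]//.
Qed.

Let one01 (x : int) : 1 <= x -> 0 <= (1 : R) <= 1.
Proof. by rewrite ler01 lexx. Qed.

Lemma phi_le1 : phi C v <= 1.
Proof.
by rewrite phiE; have /andP[] := stopped_value_bounds _ _ _ v01 one01 C 0.
Qed.

(** Seen from its starting point n, the barrier -1 recedes as n grows while the
    target n + 1 stays one unit above; on each path the first passage to 1, if it
    occurs, precedes that to a far enough barrier. *)
Lemma payoff_eventually omega : \forall n \near \oo,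
  payoff v (outside n.+1%:Z) (above n.+1%:Z) C n%:Z omega =
  payoff v (fun x => 1 <= x) (fun=> 1) C 0 omega.
Proof.
have walkE n k : walk C n%:Z k omega = n%:Z + walk C 0 k omega.
  by rewrite -walk_translate addr0.
case E : (exit_time (fun x => 1 <= x) C 0 omega) => [m|].
  have -> : payoff v (fun x => 1 <= x) (fun=> 1) C 0 omega = v ^+ m by rewrite /payoff E mulr1.
  move/eqP/first_timeP : E => [Em Eb].
  (* this sum bounds how far down the path goes before its first passage *)
  exists (\sum_(k < m.+1) `|walk C 0 k omega|)%N => // n /= nN.
  rewrite /payoff (_ : exit_time _ _ _ _ = Some m).
    by rewrite /above walkE (_ : n.+1%:Z <= _) ?mulr1//; lia.
  apply/eqP/first_timeP; split; first by rewrite /outside walkE; apply/orP; left; lia.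
  move=> k km; have /= := Eb k km; rewrite -ltNge => Xk.
  have : (`|walk C 0 k omega| <= n)%N.
    apply: leq_trans nN; rewrite (bigD1 (Ordinal (ltnW km : k < m.+1)%N))//=; exact: leq_addr.
  by rewrite /outside walkE; lia.
have -> : payoff v (fun x => 1 <= x) (fun=> 1) C 0 omega = 0 by rewrite /payoff E.
apply: nearW => n; rewrite /payoff; case: (exit_time _ _ _ _) => [m|]//.
rewrite /above walkE; move/eqP/first_time_NoneP : E => /(_ m) /= Em.
by rewrite (_ : (_ <= _) = false) ?mulr0//; lia.
Qed.

(** Dominated convergence along [payoff_eventually]. *)
Lemma upward_exit_cvg_phi : upward_exit n.+1%:Z n%:Z @[n --> \oo] --> phi C v.
Proof.
have measurable_n (n : nat) := measurable_payoff _ _ _ v01 (@above01 n.+1%:Z) C n%:Z.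
have dominated (n : nat) omega :
    (`|(payoff v (outside n.+1%:Z) (above n.+1%:Z) C n%:Z omega)%:E| <= cst 1 omega)%E.
  have /andP[b0 b1] := payoff_bounds _ _ _ v01 (@above01 n.+1%:Z) C n%:Z omega.
  by rewrite /= lee_fin ger0_norm.
have pointwise omega : (payoff v (outside n.+1%:Z) (above n.+1%:Z) C n%:Z omega)%:E
    @[n --> \oo] --> (payoff v (fun x => 1 <= x) (fun=> 1) C 0 omega)%:E.
  apply: cvg_near_cst; apply: filterS (payoff_eventually omega) => n.
  by move=> ->.
have [_ _] := dominated_convergence measurableT measurable_n
  (measurable_payoff _ _ _ v01 one01 C 0)
  (aeW _ (fun omega _ => pointwise omega))
  (finite_measure_integrable_cst P 1 measurableT)
  (aeW _ (fun omega n _ => dominated n omega)).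
rewrite phiE -/(expected_payoff v (fun x => 1 <= x) (fun=> 1) C 0).
by rewrite -(stopped_valueE _ _ _ v01 one01) => /fine_cvg.
Qed.

(** The ratio W(n) / W(n+1) = upward_exit (n+1) n tends to phi, so the radius of
    convergence is phi. *)
Lemma cvg_W_series (z : R) : 0 < z < phi C v -> cvgn (pseries (fun n => W p C v n%:Z) z).
Proof.
move=> /andP[z0 zphi].
(* any level strictly between z and phi is eventually below the ratio *)
pose y := (z + phi C v) / 2.
have [zy yphi] : z < y /\ y < phi C v by rewrite /y; split; lra.
have y0 : 0 < y by exact: lt_trans zy.
have [N _ hN] : \forall n \near \oo, y <= upward_exit n.+1%:Z n%:Z.
  exact: cvgr_ge upward_exit_cvg_phi _ yphi.
apply: (@ratio_test _ _ (z / y) N) => [n||n /hN /= yn].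
- by rewrite mulr_ge0 ?exprn_ge0 ?ltW// W_gt0.
- by rewrite divr_ge0 ?ltW//= ltr_pdivrMr// mul1r.
rewrite -(W_ratio n) exprS [leRHS](_ : _ = (W p C v n.+1%:Z * (z * z ^+ n)) * (upward_exit n.+1%:Z n%:Z / y)).
  rewrite ler_peMr//; first by rewrite !mulr_ge0 ?exprn_ge0 ?ltW// W_gt0.
  by rewrite ler_pdivlMr// mul1r.
ring.
Qed.

(** In particular pgf p z - z / v is nonzero for 0 < z < phi. *)
Lemma W_gf (z : R) : 0 < z < phi C v ->
  (pgf p z - z / v) * limn (pseries (fun n => W p C v n%:Z) z) = 1.
Proof.
move=> zphi; have /andP[z0 z1] := zphi.
have z01 : 0 <= z <= 1 by rewrite ltW//= ltW// (lt_le_trans z1)// phi_le1.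
have W_rec (n : nat) : W p C v n%:Z / v =
    \sum_(0 <= k < n.+2) p k * W p C v (n.+1 - k)%N%:Z + (fun=> 0) n.+1.
  by rewrite addr0 W_step.
have t0 : pseries (fun=> 0 : R) z @ \oo --> (0 : R).
  apply: cvg_near_cst; apply: nearW => n.
  by rewrite /pseries /series /= big1// => k _; rewrite mul0r.
have -> := generating_function_equation p _ _ v z _ _ _ p_ge0
  (fun n => ltW (W_gt0 n)) (ltW z0) W_rec
  (cvg_pgf p z p_ge0 (cvgP _ p_sum1) z01) (cvg_W_series z zphi) t0.
by rewrite W0 addr0 subr0 divff// lt0r_neq0.
Qed.

(** * The functions Psi and Z, and the generating function of Z *)

Section Psi.
Variable w : R.
Hypothesis hw : 0 < w <= 1.

Let overshoot (x : int) : R := w ^ (- x).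

Let overshoot01 (x : int) : x <= -1 -> 0 <= overshoot x <= 1.
Proof.
have /andP[w0 w1] := hw.
case: x => [n|n] xn; first by lia.
by rewrite /overshoot NegzE opprK -exprnP exprn_ge0 ?exprn_ile1// ltW.
Qed.

Lemma PsiE (x : int) : Psi C v x w =
  stopped_value v (fun x => x <= -1) overshoot C x.
Proof.
apply: expect_on_stopped => omega; rewrite /= /payoff /exit_time -/(tau_down C x (-1) omega).
  by case: (tau_down _ _ _ _).
by case: (tau_down _ _ _ _).
Qed.

Lemma Psi_bounds x : 0 <= Psi C v x w <= 1.
Proof. by rewrite PsiE; exact: stopped_value_bounds. Qed.

(** The steps k >= x + 2 lead below 0, where Psi is w to the overshoot; they make up
    the weighted tail. *)
Lemma Psi_step (x : nat) : Psi C v x%:Z w / v =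
  \sum_(0 <= k < x.+2) p k * Psi C v (x.+1 - k)%N%:Z w + weighted_tail p w x.+1.
Proof.
have /andP[v0 _] := hv.
have : ~~ (x%:Z <= -1) by lia.
move/(stopped_value_first_step _ _ _ v01 overshoot01 p C p_ge0 C_indep C_law).
under eq_fun do rewrite -PsiE; rewrite -PsiE => H.
apply: (mulIf (lt0r_neq0 v0)); rewrite divfK ?lt0r_neq0//.
suff: series (fun k => v * (p k * Psi C v (x%:Z + 1 - k%:Z) w)) @ \oo -->
    (\sum_(0 <= k < x.+2) p k * Psi C v (x.+1 - k)%N%:Z w + weighted_tail p w x.+1) * v.
  exact: cvg_unique.
rewrite -(cvg_shiftn x.+2).
rewrite (_ : [sequence _]_n = fun n => (\sum_(0 <= k < x.+2) p k * Psi C v (x.+1 - k)%N%:Z w +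
    series (fun k => p (x.+2 + k)%N * w ^+ k.+1) n) * v).
  apply: cvgM; last exact: cvg_cst.
  by apply: cvgD; [exact: cvg_cst|exact: weighted_tailE].
apply/funext => n /=; rewrite series_addn mulrDl; congr (_ + _).
  rewrite /series /= mulr_suml [LHS]big_nat [RHS]big_nat; apply: eq_bigr => k /andP[_ kx].
  rewrite mulrC; congr (_ * Psi _ _ _ _ * _); lia.
rewrite /series /= -{1}[x.+2]add0n big_addn addnK mulr_suml; apply: eq_bigr => k _.
rewrite mulrC addnC; congr (_ * _ * _).
rewrite PsiE (stopped_value_in _ _ _ v01 overshoot01 p C p_ge0 C_indep C_law); last by lia.
by rewrite /overshoot exprnP; congr (w ^ _); lia.
Qed.

Lemma alpha_spec : 0 <= alpha p C v w /\ Psi C v 0 w + alpha p C v w * W p C v 0 = 1.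
Proof.
apply: (getPex (P := [set a | 0 <= a /\ Psi C v 0 w + a * W p C v 0 = 1])).
have /andP[_ Psi1] := Psi_bounds 0.
exists (p 0%N * (1 - Psi C v 0 w)); split; first by rewrite mulr_ge0 ?subr_ge0.
by rewrite W0 mulrAC divff ?lt0r_neq0// mul1r addrCA subrr addr0.
Qed.

Lemma Z_gf (z : R) : 0 < z < phi C v ->
  pseries (fun x : nat => Z p C v x%:Z w) z @ \oo -->
    1 / (pgf p z - z / v) * pgf_quotient p z w.
Proof.
move=> zphi; have /andP[z0 z1] := zphi; have /andP[v0 _] := hv.
have z_lt1 : z < 1 by rewrite (lt_le_trans z1)// phi_le1.
have z01 : 0 <= z <= 1 by rewrite !ltW.
have z01' : 0 <= z < 1 by rewrite ltW.
have [alpha_ge0 Z0] := alpha_spec.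
have D0 : pgf p z - z / v != 0.
  by apply/negP => /eqP D0; have := W_gf z zphi; rewrite D0 mul0r => /eqP; rewrite eq_sym oner_eq0.
have cZ : cvgn (pseries (fun x : nat => Z p C v x%:Z w) z).
  rewrite (_ : pseries _ z = series ((fun n => Psi C v n%:Z w * z ^+ n) +
     alpha p C v w *: (fun n => W p C v n%:Z * z ^+ n))).
    apply: is_cvg_seriesD; first by apply: cvg_pseries_bounded => // n; exact: Psi_bounds.
    by apply: is_cvg_seriesZ; exact: cvg_W_series.
  rewrite /pseries; congr series; apply/funext => n.
  by rewrite -[LHS]/(Z p C v n%:Z w * z ^+ n) /Z mulrDl -mulrA.
have ctail : cvgn (pseries (weighted_tail p w) z).
  by apply: cvg_pseries_bounded => // n; exact: weighted_tail_bounds.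
have Z_rec (n : nat) : Z p C v n%:Z w / v =
    \sum_(0 <= k < n.+2) p k * Z p C v (n.+1 - k)%N%:Z w + weighted_tail p w n.+1.
  rewrite /Z mulrDl Psi_step -mulrA W_step mulr_sumr addrAC -big_split /=.
  by congr (_ + _); apply: eq_bigr => k _; ring.
have Z_ge0 (n : nat) : 0 <= Z p C v n%:Z w.
  have /andP[Psi0 _] := Psi_bounds n%:Z.
  by rewrite addr_ge0// mulr_ge0// ltW// W_gt0.
have E := generating_function_equation p _ _ v z _ _ _ p_ge0 Z_ge0 (ltW z0) Z_rec
  (cvg_pgf p z p_ge0 (cvgP _ p_sum1) z01) cZ ctail.
suff -> : 1 / (pgf p z - z / v) * pgf_quotient p z w =
    limn (pseries (fun x : nat => Z p C v x%:Z w) z) by [].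
apply: (mulfI D0); rewrite mulrA mulrCA divff// mulr1 mul1r E.
rewrite pgf_quotientE//; last by rewrite z0.
have -> : Z p C v 0 w = 1 by exact: Z0.
by rewrite /weighted_tail big_nat1 !expr0 divr1 !mulr1 addrCA subrr addr0.
Qed.
End Psi.
End Scale.

Theorem mainTheorem1 (d : measure_display) (T : measurableType d)
    (R : realType) (P : probability T R)
    (p : nat -> R) (C : nat -> {RV P >-> nat})
    (p_ge0 : forall k : nat, 0 <= p k)
    (p_sum1 : series p @ \oo --> (1 : R))
    (p0_gt0 : 0 < p 0%N)
    (C_indep : mutually_independent C)
    (C_law : forall i k : nat, P (C i @^-1` [set k]) = (p k)%:E)
    (v w z : R) (hv : 0 < v <= 1) (hw : 0 < w <= 1) (hz : 0 < z < phi C v) :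
  series (fun x : nat => z ^+ x * Z p C v x%:Z w) @ \oo -->
    1 / (pgf p z - z / v) * pgf_quotient p z w.
Proof.
under eq_fun do rewrite mulrC.
exact: (Z_gf p C v p_ge0 p_sum1 p0_gt0 C_indep C_law hv w hw z hz).
Qed.
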